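(* Let $K$ be a field of characteristic zero and let $R = K[X_1,\ldots,X_n]$ be graded by $\deg X_i = \omega_i$, where $\omega_1,\ldots,\omega_n$ are positive integers. Set $\omega = \sum_{i=1}^{n}\omega_i$. Let $I$ be a graded ideal in $R$. Then the De Rham cohomology modules $H^i(\partial_1,\ldots,\partial_n; H^j_I(R))$, for all $i,j \geq 0$, are concentrated in degree $-\omega$, i.e., $$H^i(\partial_1,\ldots,\partial_n; H^j_I(R))_l = 0 \quad \text{for all } l \neq -\omega .$$
   Context: $A_n(K) = K\langle X_1,\ldots,X_n,\partial_1,\ldots,\partial_n\rangle$ is the $n$-th Weyl algebra over $K$ ($\partial_i = \partial/\partial X_i$), graded by $\deg X_i = \omega_i$ and $\deg \partial_i = -\omega_i$. The local cohomology modules $H^j_I(R)$ carry their natural structure of graded left $A_n(K)$-modules. For a graded module $M$ and $l\in\mathbb{Z}$, $M(l)$ is the shift, $M(l)_j = M_{j+l}$. For a graded left $A_n(K)$-module $M$, the De Rham homology $H_i(\partial_1,\ldots,\partial_n;M)$ is the $i$-th Koszul homology of $M$ with respect to the pairwise commuting $K$-linear maps $\partial_1,\ldots,\partial_n$; it is a graded $K$-vector space, computed from the Koszul complex graded so that its term in homological degree $i$ is $\bigoplus_{1\le j_1<\cdots<j_i\le n} M(\omega_{j_1}+\cdots+\omega_{j_i})$ (so the term in homological degree $0$ is $M$ and the differentials have degree $0$). De Rham cohomology is $H^i(\partial_1,\ldots,\partial_n;M) = H_{n-i}(\partial_1,\ldots,\partial_n;M)$, with this grading. *)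

(* Defs.v *)
From HB Require Import structures.
From mathcomp Require Import all_boot all_order all_algebra ring.
From mathcomp Require Import mpoly.
From mathcomp Require Import boolp.

Set Implicit Arguments.
Unset Strict Implicit.
Unset Printing Implicit Defensive.
Import GRing.Theory Num.Theory Order.TTheory.
Local Open Scope ring_scope.
Local Open Scope quotient_scope.

Lemma submod_rpredB (K : fieldType) (V : lmodType K) (P : submodClosed V) :
  {in P &, forall x y, x - y \in P}.
Proof.
by move=> x y xP yP; rewrite -scaleN1r; apply: rpredD => //; apply: rpredZ.
Qed.

Section Submodule.
Variables (K : fieldType) (V : lmodType K) (Z : submodClosed V).

Record submod := Submod { submod_val :> V; submod_valP : submod_val \in Z }.
HB.instance Definition _ := [isSub for submod_val].
HB.instance Definition _ := [Choice of submod by <:].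
HB.instance Definition _ := [SubChoice_isSubLmodule of submod by <:].

End Submodule.

(** [subquot Z B] is Z / (Z \cap B); in the uses below B is contained in Z. *)
Section Subquotient.
Variables (K : fieldType) (V : lmodType K) (Z B : submodClosed V).

Definition submod_meet : {pred submod Z} := [pred z | val z \in B].

Fact submod_meet_submod : submod_closed submod_meet.
Proof.
split=> [|a x y]; first by rewrite inE raddf0 rpred0.
by rewrite !inE linearP => xB yB; apply: rpredD => //; apply: rpredZ.
Qed.
HB.instance Definition _ := GRing.isSubmodClosed.Build K (submod Z)
  submod_meet submod_meet_submod.

Definition subquot := Quotient.quot submod_meet.
HB.instance Definition _ := GRing.Zmodule.on subquot.

Definition subquot_pi (z : submod Z) : subquot := \pi z.

Lemma subquot_piD x y : subquot_pi (x + y) = subquot_pi x + subquot_pi y.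
Proof. by rewrite /subquot_pi [LHS]Quotient.pi_add. Qed.

Lemma subquot_piP (x : subquot) : exists z, x = subquot_pi z.
Proof. by exists (repr x); rewrite /subquot_pi reprK. Qed.

Lemma subquot_eq (x y : submod Z) :
  (subquot_pi x = subquot_pi y) <-> (val x - val y \in B).
Proof.
have E : (x - y \in submod_meet) = (val x - val y \in B) by rewrite inE raddfB.
by rewrite -E Quotient.idealrBE; split=> [?|/eqP //]; apply/eqP.
Qed.

Definition subquot_scale (a : K) (x : subquot) : subquot :=
  subquot_pi (a *: repr x).

Lemma subquot_piZ a z : subquot_pi (a *: z) = subquot_scale a (subquot_pi z).
Proof.
have zB : val z - val (repr (subquot_pi z)) \in B.
  by apply/subquot_eq; rewrite /subquot_pi reprK.
by apply/subquot_eq; rewrite !linearZ /= -scalerDr; exact: rpredZ.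
Qed.

Fact subquot_scaleA a b x :
  subquot_scale a (subquot_scale b x) = subquot_scale (a * b) x.
Proof. by have [z ->] := subquot_piP x; rewrite -!subquot_piZ scalerA. Qed.
Fact subquot_scale1 : left_id 1 subquot_scale.
Proof. by move=> x; have [z ->] := subquot_piP x; rewrite -!subquot_piZ scale1r. Qed.
Fact subquot_scaleDr : right_distributive subquot_scale +%R.
Proof.
move=> a x y; have [z ->] := subquot_piP x; have [t ->] := subquot_piP y.
by rewrite -subquot_piD -!subquot_piZ -subquot_piD scalerDr.
Qed.
Fact subquot_scaleDl x : {morph subquot_scale^~ x : a b / a + b}.
Proof.
move=> a b; have [z ->] := subquot_piP x.
by rewrite -!subquot_piZ -subquot_piD scalerDl.
Qed.
HB.instance Definition _ := GRing.Zmodule_isLmodule.Build K subquot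
  subquot_scaleA subquot_scale1 subquot_scaleDr subquot_scaleDl.

Fact subquot_pi_linear : linear subquot_pi.
Proof. by move=> a x y; rewrite subquot_piD subquot_piZ. Qed.
HB.instance Definition _ := GRing.isLinear.Build K (submod Z) subquot _
  subquot_pi subquot_pi_linear.

Lemma subquot_eq0 (x : submod Z) : (subquot_pi x = 0) <-> (val x \in B).
Proof. by have := subquot_eq x 0; rewrite raddf0 (raddf0 val) subr0. Qed.

Definition subquot_im (G : submodClosed V) : {pred subquot} :=
  [pred x | `[< exists2 z, x = subquot_pi z & val z \in G >]].

Lemma subquot_imP (G : submodClosed V) x :
  reflect (exists2 z, x = subquot_pi z & val z \in G) (x \in subquot_im G).
Proof. exact: asboolP. Qed.

Fact subquot_im_submod G : submod_closed (subquot_im G).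
Proof.
split=> [|a _ _ /subquot_imP[x -> xG] /subquot_imP[y -> yG]].
  by apply/subquot_imP; exists 0; rewrite raddf0 ?rpred0.
apply/subquot_imP; exists (a *: x + y); rewrite linearP //.
by apply: rpredD => //; apply: rpredZ.
Qed.
HB.instance Definition _ G := GRing.isSubmodClosed.Build K subquot
  (subquot_im G) (subquot_im_submod G).

Section Map.
Variables (T : {linear V -> V}).
Hypotheses (TZ : {homo T : x / x \in Z}) (TB : {homo T : x / x \in B}).

Definition submod_map (z : submod Z) : submod Z := Submod (TZ (submod_valP z)).
Definition subquot_map of {homo T : x / x \in B} := fun x : subquot =>
  subquot_pi (submod_map (repr x)).

Lemma subquot_mapE z :
  subquot_map TB (subquot_pi z) = subquot_pi (submod_map z).
Proof.
apply/subquot_eq; rewrite /= -raddfB; apply: TB.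
by apply/subquot_eq; rewrite /subquot_pi reprK.
Qed.

Fact subquot_map_linear : linear (subquot_map TB).
Proof.
move=> a x y; have [z ->] := subquot_piP x; have [t ->] := subquot_piP y.
rewrite -linearP !subquot_mapE -linearP; congr subquot_pi.
by apply: val_inj; rewrite /= !linearP.
Qed.
HB.instance Definition _ := GRing.isLinear.Build K subquot subquot _
  (subquot_map TB) subquot_map_linear.
End Map.

Lemma subquot_map_comm (T U : {linear V -> V}) k
  (TZ : {homo T : x / x \in Z}) (TB : {homo T : x / x \in B})
  (UZ : {homo U : x / x \in Z}) (UB : {homo U : x / x \in B}) :
  (forall x, T (U x) = U (T x) + x *+ k) -> forall x : subquot,
  subquot_map TZ TB (subquot_map UZ UB x)
    = subquot_map UZ UB (subquot_map TZ TB x) + x *+ k.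
Proof.
move=> TU x; have [z ->] := subquot_piP x.
rewrite !subquot_mapE -raddfMn -raddfD; congr subquot_pi; apply: val_inj.
by rewrite raddfD raddfMn /= TU.
Qed.

End Subquotient.
Arguments subquot_pi {K V Z} B z.
Arguments subquot_im {K V} Z B G _.

Section Grading.
Variables (K : fieldType) (V : lmodType K) (G : int -> submodClosed V).

Definition independent := forall (r : seq int) (y : int -> V), uniq r ->
  (forall d, y d \in G d) -> \sum_(d <- r) y d = 0 ->
  forall d, d \in r -> y d = 0.

Definition graded_pred (P : {pred V}) := forall x, x \in P ->
  exists (r : seq int) (y : int -> V), [/\ uniq r,
    forall d, y d \in G d, forall d, y d \in P & x = \sum_(d <- r) y d].

Definition is_grading := independent /\ graded_pred predT.
End Grading.

Record gradedSpace (K : fieldType) := GradedSpace {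
  gs_sort :> lmodType K;
  gs_deg : int -> submodClosed gs_sort;
  gs_grading : is_grading gs_deg
}.

Section GradingTheory.
Variables (K : fieldType) (V : lmodType K) (G : int -> submodClosed V).

Lemma graded_predW (P : submodClosed V) x : graded_pred G P -> x \in P ->
  exists (r : seq int) (y : int -> V), [/\ forall d, y d \in G d,
    forall d, y d \in P, forall d, d \notin r -> y d = 0 &
    forall r', uniq r' -> {subset r <= r'} -> x = \sum_(d <- r') y d].
Proof.
move=> gP /gP[r [y [ur yG yP xE]]].
exists r, (fun d => if d \in r then y d else 0); split.
- by move=> d; case: ifP => _; rewrite ?rpred0.
- by move=> d; case: ifP => _; rewrite ?rpred0.
- by move=> d /negbTE->.
move=> r' ur' rr'; rewrite xE -big_mkcond -big_filter; apply: perm_big.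
apply: uniq_perm; rewrite ?filter_uniq // => d.
by rewrite mem_filter andb_idr // => /rr'.
Qed.

Lemma independent_graded (P : submodClosed V) (r : seq int) (y : int -> V) :
  independent G -> graded_pred G P -> uniq r -> (forall d, y d \in G d) ->
  \sum_(d <- r) y d \in P -> forall d, d \in r -> y d \in P.
Proof.
move=> iG gP ur yG /(graded_predW gP)[r0 [z [zG zP z0 zE]]] d dr.
pose r' := undup (r ++ r0).
have yE : \sum_(d <- r) y d = \sum_(d <- r') (if d \in r then y d else 0).
  rewrite -big_mkcond -big_filter; apply: perm_big.
  apply: uniq_perm; rewrite ?filter_uniq ?undup_uniq // => e.
  by rewrite mem_filter mem_undup mem_cat; case: (e \in r).
pose u d := (if d \in r then y d else 0) - z d.
have u0 : \sum_(e <- r') u e = 0.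
  rewrite sumrB -yE (zE r') ?undup_uniq ?subrr // => e.
  by rewrite mem_undup mem_cat orbC => ->.
have uG e : u e \in G e by apply: submod_rpredB => //; case: ifP => _; rewrite ?rpred0.
have dr' : d \in r' by rewrite mem_undup mem_cat dr.
have /eqP := iG r' u (undup_uniq _) uG u0 d dr'.
by rewrite /u dr subr_eq0 => /eqP ->.
Qed.

Variables (Z B : submodClosed V).
Hypotheses (iG : independent G) (gZ : graded_pred G Z) (gB : graded_pred G B).

Lemma subquot_grading : is_grading (fun d => subquot_im Z B (G d)).
Proof.
split=> [r y ur yG|x _].
  have /choice[z zP] d : exists z : submod Z,
      y d = subquot_pi B z /\ val z \in G d.
    by have /subquot_imP[z ? ?] := yG d; exists z.
  rewrite (eq_bigr (fun d => subquot_pi B (z d))) => [|d _]; last exact: (zP d).1.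
  rewrite -raddf_sum => /subquot_eq0; rewrite raddf_sum => sB d dr.
  rewrite (zP d).1; apply/subquot_eq0.
  apply: (independent_graded iG gB ur _ sB dr) => e; exact: (zP e).2.
have [z ->] := subquot_piP x.
have [r [y [ur yG yZ zE]]] := gZ (submod_valP z).
exists r, (fun d => subquot_pi B (Submod (yZ d))); split=> // [d|].
  by apply/subquot_imP; exists (Submod (yZ d)) => //=; apply: yG.
rewrite -raddf_sum; congr subquot_pi; apply: val_inj.
by rewrite raddf_sum.
Qed.

End GradingTheory.

(** The complex is given inside one space V: [C] is the term at the place
    considered, [C'] the preceding one, and [dd] restricts to the two
    differentials C' -> C and out of C. *)

Section Homology.
Variables (K : fieldType) (V : lmodType K) (G : int -> submodClosed V).
Variables (dd : {linear V -> V}) (C C' : submodClosed V).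

Definition cycles : {pred V} := [pred x | (x \in C) && (dd x == 0)].

Fact cycles_submod : submod_closed cycles.
Proof.
split=> [|a x y]; first by rewrite inE rpred0 raddf0 eqxx.
rewrite !inE => /andP[xC /eqP x0] /andP[yC /eqP y0].
rewrite linearP x0 y0 scaler0 addr0 eqxx andbT.
by apply: rpredD => //; apply: rpredZ.
Qed.
HB.instance Definition _ := GRing.isSubmodClosed.Build K V cycles cycles_submod.

Definition boundaries : {pred V} :=
  [pred x | `[< exists2 y, y \in C' & x = dd y >]].

Lemma boundariesP x :
  reflect (exists2 y, y \in C' & x = dd y) (x \in boundaries).
Proof. exact: asboolP. Qed.

Fact boundaries_submod : submod_closed boundaries.
Proof.
split=> [|a _ _ /boundariesP[x xC ->] /boundariesP[y yC ->]].
  by apply/boundariesP; exists 0; rewrite ?rpred0 ?raddf0.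
apply/boundariesP; exists (a *: x + y); last by rewrite linearP.
by apply: rpredD => //; apply: rpredZ.
Qed.
HB.instance Definition _ :=
  GRing.isSubmodClosed.Build K V boundaries boundaries_submod.

Hypotheses (iG : independent G) (gC : graded_pred G C) (gC' : graded_pred G C').
Hypothesis ddG : forall d, {homo dd : x / x \in G d}.

Lemma cycles_graded : graded_pred G cycles.
Proof.
move=> x; rewrite inE => /andP[/(graded_predW gC)[r [y [yG yC y0 /(_ (undup r))]]]].
move=> /(_ (undup_uniq _)) xE /eqP dx0.
have {}xE : x = \sum_(d <- undup r) y d by apply: xE => d; rewrite mem_undup.
exists (undup r), y; split=> // [|d]; first exact: undup_uniq.
rewrite inE yC /=; have [dr|/y0->] := boolP (d \in r); last by rewrite raddf0.
apply/eqP; move: dx0; rewrite xE raddf_sum => dx0.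
apply: (iG (undup_uniq r) _ dx0); last by rewrite mem_undup.
by move=> e; apply: ddG.
Qed.

Lemma boundaries_graded : graded_pred G boundaries.
Proof.
move=> _ /boundariesP[x /gC'[r [y [ur yG yC xE]]] ->].
exists r, (dd \o y); split=> // [d|d|]; first exact: ddG.
  by apply/boundariesP; exists (y d).
by rewrite xE raddf_sum.
Qed.

Definition homology : gradedSpace K :=
  GradedSpace (subquot_grading iG cycles_graded boundaries_graded).

Section Map.
Variable T : {linear V -> V}.
Hypotheses (Tdd : forall x, T (dd x) = dd (T x))
  (TC : {homo T : x / x \in C}) (TC' : {homo T : x / x \in C'}).

Lemma cycles_homo : {homo T : x / x \in cycles}.
Proof.
move=> x; rewrite !inE => /andP[xC /eqP x0].
by rewrite TC //= -Tdd x0 raddf0.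
Qed.

Lemma boundaries_homo : {homo T : x / x \in boundaries}.
Proof.
by move=> _ /boundariesP[y yC ->]; apply/boundariesP; exists (T y); auto.
Qed.

Definition homology_map : {linear homology -> homology} :=
  subquot_map cycles_homo boundaries_homo.

Lemma homology_map_deg (a : int) :
  (forall d x, x \in G d -> T x \in G (d + a)) ->
  forall d (x : homology), x \in gs_deg homology d ->
    homology_map x \in gs_deg homology (d + a).
Proof.
move=> TG d _ /subquot_imP[z -> zG]; apply/subquot_imP.
exists (submod_map cycles_homo z); first exact: subquot_mapE.
exact: TG.
Qed.

End Map.
End Homology.

Section Families.
Variables (K : fieldType) (W : lmodType K).

Definition full_sub : {pred W} := predT.
Fact full_sub_submod : submod_closed full_sub. Proof. by []. Qed.
HB.instance Definition _ := GRing.isSubmodClosed.Build K W full_sub full_sub_submod.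

Definition cond_sub (b : bool) (P : submodClosed W) : {pred W} :=
  [pred x | if b then x \in P else x == 0].
Fact cond_sub_submod b P : submod_closed (cond_sub b P).
Proof.
split=> [|a x y]; first by rewrite inE eqxx rpred0 if_same.
rewrite !inE; case: b => [xP yP|/eqP-> /eqP->].
  by apply: rpredD => //; apply: rpredZ.
by rewrite scaler0 addr0.
Qed.
HB.instance Definition _ b P :=
  GRing.isSubmodClosed.Build K W (cond_sub b P) (cond_sub_submod b P).

Lemma cond_sub_map (b : bool) (P : submodClosed W) (F : {linear W -> W}) :
  {homo F : x / x \in P} -> {homo F : x / x \in cond_sub b P}.
Proof.
move=> FP x; rewrite !inE; case: b => [|/eqP->]; [exact: FP|].
by rewrite raddf0.
Qed.

Lemma cond_sub_graded (b : bool) (G : int -> submodClosed W) (P : submodClosed W) :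
  (b -> graded_pred G P) -> graded_pred G (cond_sub b P).
Proof.
move=> gP x; rewrite inE; case: b gP => [gP xP|_ /eqP->].
  have [r [y [ur yG yP xE]]] := gP isT x xP.
  by exists r, y.
exists [::], (fun=> 0); split=> // [d|d|]; rewrite ?rpred0 ?inE //.
by rewrite big_nil.
Qed.

Lemma independent_shift a (G : int -> submodClosed W) :
  independent G -> independent (fun d => G (d + a)).
Proof.
move=> iG r y ur yG y0 d dr.
have ur' : uniq [seq e + a | e <- r] by rewrite map_inj_uniq //; apply: addIr.
rewrite -[d](addrK a); apply: (iG _ (fun e => y (e - a)) ur') => [e||].
- by have := yG (e - a); rewrite subrK.
- by rewrite big_map -[RHS]y0; apply: eq_bigr => e _; rewrite addrK.
- exact: map_f.
Qed.

Lemma graded_pred_shift a (G : int -> submodClosed W) (P : {pred W}) :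
  graded_pred G P -> graded_pred (fun d => G (d + a)) P.
Proof.
move=> gP x /gP[r [y [ur yG yP xE]]].
exists [seq e - a | e <- r], (fun d => y (d + a)); split=> //.
  by rewrite map_inj_uniq //; apply: addIr.
by rewrite big_map xE; apply: eq_bigr => e _; rewrite subrK.
Qed.

Variable T : finType.

Definition ffun_sub (P : T -> submodClosed W) : {pred {ffun T -> W}} :=
  [pred c : {ffun T -> W} | [forall t, c t \in P t]].

Lemma ffun_subP (P : T -> submodClosed W) (c : {ffun T -> W}) : reflect (forall t, c t \in P t) (c \in ffun_sub P).
Proof. exact: forallP. Qed.

Fact ffun_sub_submod P : submod_closed (ffun_sub P).
Proof.
split=> [|a x y /ffun_subP xP /ffun_subP yP].
  by apply/ffun_subP => t; rewrite ffunE rpred0.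
by apply/ffun_subP => t; rewrite !ffunE; apply: rpredD => //; apply: rpredZ.
Qed.
HB.instance Definition _ P :=
  GRing.isSubmodClosed.Build K {ffun T -> W} (ffun_sub P) (ffun_sub_submod P).

Variable G : T -> int -> submodClosed W.

Lemma ffun_independent : (forall t, independent (G t)) ->
  independent (fun d => ffun_sub (G^~ d)).
Proof.
move=> iG r y ur yG y0 d dr; apply/ffunP => t; rewrite ffunE.
apply: (iG t r (fun e => y e t)) => // [e|]; first exact: (ffun_subP _ _ (yG e)).
by have /ffunP/(_ t) := y0; rewrite sum_ffunE ffunE.
Qed.

Lemma ffun_graded (P : T -> submodClosed W) :
  (forall t, graded_pred (G t) (P t)) ->
  graded_pred (fun d => ffun_sub (G^~ d)) (ffun_sub P).
Proof.
move=> gP x /ffun_subP xP.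
have /choice[ry ryP] t : exists ry : seq int * (int -> W),
    [/\ forall d, ry.2 d \in G t d, forall d, ry.2 d \in P t &
      forall r', uniq r' -> {subset ry.1 <= r'} -> x t = \sum_(d <- r') ry.2 d].
  by have [r [y [? ? _ ?]]] := graded_predW (gP t) (xP t); exists (r, y).
pose r := undup (flatten [seq (ry t).1 | t : T]).
exists r, (fun d => [ffun t => (ry t).2 d]); split; first exact: undup_uniq.
- by move=> d; apply/ffun_subP => t; rewrite ffunE; have [] := ryP t.
- by move=> d; apply/ffun_subP => t; rewrite ffunE; have [] := ryP t.
apply/ffunP => t; rewrite sum_ffunE; have [_ _ /(_ r) ->] := ryP t.
- by apply: eq_bigr => d _; rewrite ffunE.
- exact: undup_uniq.
move=> d dr; rewrite mem_undup; apply/flatten_mapP; exists t => //.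
by rewrite mem_enum.
Qed.

Definition ffun_map (F : {linear W -> W}) (c : {ffun T -> W}) : {ffun T -> W} :=
  [ffun t => F (c t)].
Fact ffun_map_linear F : linear (ffun_map F).
Proof. by move=> a x y; apply/ffunP => t; rewrite !ffunE linearP. Qed.
HB.instance Definition _ F := GRing.isLinear.Build K {ffun T -> W} {ffun T -> W}
  _ (ffun_map F) (ffun_map_linear F).

Lemma ffun_map_comm (F E : {linear W -> W}) k :
  (forall x, F (E x) = E (F x) + x *+ k) -> forall c : {ffun T -> W},
  ffun_map F (ffun_map E c) = ffun_map E (ffun_map F c) + c *+ k.
Proof. by move=> FE c; apply/ffunP => t; rewrite !ffunE ffunMnE FE. Qed.

End Families.
Arguments full_sub {K} W _.

(** A left A_n(K)-module is a K-vector space with endomorphisms X_i and D_i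
    satisfying the defining relations of A_n(K). *)
Record gradedWeylModule (K : fieldType) (n : nat) (w : 'I_n -> nat) :=
  GradedWeylModule {
  gwm_space :> gradedSpace K;
  gwm_X : 'I_n -> {linear gwm_space -> gwm_space};
  gwm_D : 'I_n -> {linear gwm_space -> gwm_space};
  gwm_XX : forall i j m, gwm_X i (gwm_X j m) = gwm_X j (gwm_X i m);
  gwm_DD : forall i j m, gwm_D i (gwm_D j m) = gwm_D j (gwm_D i m);
  gwm_DX : forall i j m,
    gwm_D i (gwm_X j m) = gwm_X j (gwm_D i m) + m *+ (i == j);
  gwm_X_deg : forall i d m, m \in gs_deg gwm_space d ->
    gwm_X i m \in gs_deg gwm_space (d + (w i)%:Z);
  gwm_D_deg : forall i d m, m \in gs_deg gwm_space d ->
    gwm_D i m \in gs_deg gwm_space (d - (w i)%:Z)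
}.

Definition pos_sign (R : pzRingType) n (S : {set 'I_n}) (t : 'I_n) : R :=
  (-1) ^+ #|[set u in S | (u < t)%N]|.

Section DeRham.
Variables (K : fieldType) (n : nat) (w : 'I_n -> nat).
Variable M : gradedWeylModule K w.

(** A function [c : {set 'I_n} -> M] stands for the element
    \sum_S c(S) e_S, where e_S = e_{j_1} /\ ... /\ e_{j_i} for
    S = {j_1 < ... < j_i}; thus the differential is
    m e_S |-> \sum_k (-1)^(k-1) D_{j_k} m e_{S \ j_k}. *)
Definition koszul_fun (c : {ffun {set 'I_n} -> M}) : {ffun {set 'I_n} -> M} :=
  [ffun S : {set 'I_n} =>
     \sum_(t | t \notin S) pos_sign K S t *: gwm_D M t (c (t |: S))].

Fact koszul_fun_linear : linear koszul_fun.
Proof.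
move=> a x y; apply/ffunP => S; rewrite !ffunE scaler_sumr -big_split /=.
apply: eq_bigr => t _; rewrite !ffunE linearP scalerDr !scalerA.
by rewrite [_ * a]mulrC.
Qed.
HB.instance Definition _ := GRing.isLinear.Build K {ffun {set 'I_n} -> M}
  {ffun {set 'I_n} -> M} _ koszul_fun koszul_fun_linear.

Definition koszul_chains (i : int) : submodClosed {ffun {set 'I_n} -> M} :=
  ffun_sub (fun S : {set 'I_n} => cond_sub (#|S|%:Z == i) (full_sub M)).

(** The summand M e_S is the shift M(\sum_(t in S) w t), where
    M(a)_l = M_(l + a). *)
Definition koszul_deg (l : int) : submodClosed {ffun {set 'I_n} -> M} :=
  ffun_sub (fun S : {set 'I_n} => gs_deg M (l + \sum_(t in S) (w t)%:Z)).

Lemma koszul_independent : independent koszul_deg.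
Proof.
apply: (@ffun_independent _ _ _ (fun (S : {set 'I_n}) l => gs_deg M (l + \sum_(t in S) (w t)%:Z))).
by move=> S; apply/independent_shift; case: (gs_grading M).
Qed.

Lemma koszul_chains_graded i : graded_pred koszul_deg (koszul_chains i).
Proof.
apply: (@ffun_graded _ _ _ (fun (S : {set 'I_n}) l => gs_deg M (l + \sum_(t in S) (w t)%:Z))).
move=> S; apply: cond_sub_graded => _.
by apply/graded_pred_shift; case: (gs_grading M).
Qed.

Lemma koszul_fun_deg l : {homo koszul_fun : c / c \in koszul_deg l}.
Proof.
move=> c /ffun_subP cG; apply/ffun_subP => S; rewrite ffunE.
apply: rpred_sum => t tS; apply: rpredZ.
have := gwm_D_deg t (cG (t |: S)); rewrite big_setU1 //=.
by rewrite addrA addrAC addrK.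
Qed.

(** The index is an integer so that [n - i] below is not truncated; the result
    is zero unless 0 <= i <= n. *)
Definition deRham_homology (i : int) : gradedSpace K :=
  homology (dd := koszul_fun) koszul_independent (@koszul_chains_graded i)
    (@koszul_chains_graded (i + 1)) koszul_fun_deg.

Definition deRham_cohomology (i : int) : gradedSpace K :=
  deRham_homology (n%:Z - i).

End DeRham.

Section WeightedDegree.
Variables (n : nat) (w : 'I_n -> nat).

Definition wdeg (m : 'X_{1..n}) : nat := (\sum_(i < n) m i * w i)%N.

Fact wdeg0 : wdeg 0%MM = 0%N.
Proof. by apply: big1 => i _; rewrite mnmE. Qed.
Fact wdegD : {morph wdeg : m1 m2 / (m1 + m2)%MM >-> (m1 + m2)%N}.
Proof.
move=> m1 m2; rewrite /wdeg -big_split; apply: eq_bigr => i _ /=.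
by rewrite mnmDE mulnDl.
Qed.
HB.instance Definition _ := isMeasure.Build n wdeg wdeg0 wdegD.

Lemma wdegU i : wdeg U_(i)%MM = w i.
Proof.
rewrite /wdeg (bigD1 i) //= mnmE eqxx mul1n big1 ?addn0 // => j /negbTE ji.
by rewrite mnmE eq_sym ji.
Qed.

Variable K : fieldType.
Implicit Types p q : {mpoly K[n]}.

Definition graded_ideal (I : {pred {mpoly K[n]}}) : Prop :=
  [/\ 0 \in I, forall a p q, p \in I -> q \in I -> a * p + q \in I &
    forall p d, p \in I -> pihomog wdeg d p \in I].

Lemma dhomog_mderiv i d p : p \is d.-homog for wdeg ->
  p^`M(i) = 0 \/ exists2 e, d = (e + w i)%N & p^`M(i) \is e.-homog for wdeg.
Proof.
move=> /dhomogP hp; have [?|nz] := eqVneq p^`M(i) 0; [by left|right].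
have H m : m \in msupp p^`M(i) -> (wdeg m + w i)%N = d.
  rewrite mcoeff_msupp mcoeff_mderiv => pm; rewrite -wdegU -wdegD.
  by apply: hp; rewrite mcoeff_msupp; apply: contraNneq pm => ->; rewrite mul0rn.
exists (wdeg (mlead p^`M(i))); first by rewrite H ?mlead_supp.
apply/dhomogP => m /H; rewrite -(H (mlead p^`M(i))) ?mlead_supp //.
exact: addIn.
Qed.

End WeightedDegree.

Section QuotientRule.
Variables (F : fieldType) (a b c d a' b' c' d' : F).
Hypotheses (nb : b != 0) (nd : d != 0).

Fact cross_div : a * d = c * b -> a / b = c / d.
Proof. by move=> E; apply/eqP; rewrite eqr_div // E. Qed.

Fact quotient_ruleD :
  (((a' * d + a * d') + (c' * b + c * b')) * (b * d)
    - (a * d + c * b) * (b' * d + b * d')) / (b * d) ^+ 2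
  = (a' * b - a * b') / b ^+ 2 + (c' * d - c * d') / d ^+ 2.
Proof. by field; rewrite nb nd. Qed.

Fact quotient_ruleM :
  ((a' * c + a * c') * (b * d) - (a * c) * (b' * d + b * d')) / (b * d) ^+ 2
  = (a' * b - a * b') / b ^+ 2 * (c / d) + a / b * ((c' * d - c * d') / d ^+ 2).
Proof. by field; rewrite nb nd. Qed.

Fact leibniz2 : a = a + b + (c + d) - (b + c + d).
Proof. by ring. Qed.
End QuotientRule.

Section Ratfun.
Variables (K : fieldType) (n : nat).

Definition ratfun := {fraction {mpoly K[n]}}.
HB.instance Definition _ := GRing.Field.on ratfun.

Implicit Types (p q : {mpoly K[n]}) (x y : ratfun).

Definition ratpoly p : ratfun := @FracField.tofrac {mpoly K[n]} p.
HB.instance Definition _ := GRing.isZmodMorphism.Build {mpoly K[n]} ratfun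
  ratpoly (@tofrac_is_zmod_morphism _).
HB.instance Definition _ := GRing.isMonoidMorphism.Build {mpoly K[n]} ratfun
  ratpoly (@tofrac_is_monoid_morphism _).

Lemma ratpolyM p q : ratpoly (p * q) = ratpoly p * ratpoly q.
Proof. exact: rmorphM. Qed.
Lemma ratpolyD p q : ratpoly (p + q) = ratpoly p + ratpoly q.
Proof. exact: rmorphD. Qed.
Lemma ratpolyB p q : ratpoly (p - q) = ratpoly p - ratpoly q.
Proof. exact: rmorphB. Qed.
Lemma ratpolyX p k : ratpoly (p ^+ k) = ratpoly p ^+ k.
Proof. exact: rmorphXn. Qed.
Lemma ratpoly0 : ratpoly 0 = 0. Proof. exact: rmorph0. Qed.
Lemma ratpoly1 : ratpoly 1 = 1. Proof. exact: rmorph1. Qed.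

Definition ratfun_scale (a : K) (x : ratfun) : ratfun := ratpoly a%:MP * x.
Fact ratfun_scaleA a b x :
  ratfun_scale a (ratfun_scale b x) = ratfun_scale (a * b) x.
Proof. by rewrite /ratfun_scale !rmorphM mulrA. Qed.
Fact ratfun_scale1 : left_id 1 ratfun_scale.
Proof. by move=> x; rewrite /ratfun_scale !rmorph1 mul1r. Qed.
Fact ratfun_scaleDr : right_distributive ratfun_scale +%R.
Proof. by move=> a x y; rewrite /ratfun_scale mulrDr. Qed.
Fact ratfun_scaleDl x : {morph ratfun_scale^~ x : a b / a + b}.
Proof. by move=> a b; rewrite /ratfun_scale !rmorphD mulrDl. Qed.
HB.instance Definition _ := GRing.Zmodule_isLmodule.Build K ratfun
  ratfun_scaleA ratfun_scale1 ratfun_scaleDr ratfun_scaleDl.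

Lemma ratfun_scaleE a x : a *: x = ratpoly a%:MP * x. Proof. by []. Qed.

Lemma ratpoly_eq0 p : (ratpoly p == 0) = (p == 0).
Proof. exact: tofrac_eq0. Qed.


Definition ratfun_num x : {mpoly K[n]} := \n_(repr x).
Definition ratfun_den x : {mpoly K[n]} := \d_(repr x).

Lemma ratfun_den_neq0 x : ratfun_den x != 0.
Proof. exact: denom_ratioP. Qed.

Lemma ratfun_numden x : x = ratpoly (ratfun_num x) / ratpoly (ratfun_den x).
Proof.
apply: (canRL (mulfK _)); first by rewrite ratpoly_eq0 ratfun_den_neq0.
rewrite -{1}[x]reprK /ratpoly; unlock FracField.tofrac.
rewrite -[LHS]FracField.pi_mul; apply/eqmodP.
rewrite /= FracField.equivfE /FracField.mulf !numden_Ratio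
  ?mulf_neq0 ?oner_neq0 ?denom_ratioP //.
by rewrite !mulr1 mulrC.
Qed.

(** The quotient rule, applied to the fraction chosen to represent [x]; the
    result does not depend on that choice, see [ratfun_derivE]. *)
Definition ratfun_deriv (i : 'I_n) (x : ratfun) : ratfun :=
  ratpoly ((ratfun_num x)^`M(i) * ratfun_den x
            - ratfun_num x * (ratfun_den x)^`M(i)) / ratpoly (ratfun_den x) ^+ 2.

Lemma ratfun_derivE i p q : q != 0 ->
  ratfun_deriv i (ratpoly p / ratpoly q)
    = ratpoly (p^`M(i) * q - p * q^`M(i)) / ratpoly q ^+ 2.
Proof.
move=> q0; set x := ratpoly p / _; rewrite /ratfun_deriv.
have := ratfun_numden x; have := ratfun_den_neq0 x.
move: (ratfun_num x) (ratfun_den x) => a b b0 xE.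
have nq : ratpoly q != 0 by rewrite ratpoly_eq0.
have nb : ratpoly b != 0 by rewrite ratpoly_eq0.
have E : p * b = a * q.
  apply/eqP; rewrite -subr_eq0 -ratpoly_eq0 ratpolyB !ratpolyM subr_eq0 /=.
  by rewrite -(eqr_div _ _ nq nb) -xE.
have dE : p^`M(i) * b + p * b^`M(i) = a^`M(i) * q + a * q^`M(i).
  by rewrite -!mderivM E.
have nb2 := expf_neq0 2 nb.
have nq2 := expf_neq0 2 nq.
apply: (cross_div nb2 nq2).
rewrite -!ratpolyX -!ratpolyM; congr ratpoly; apply/eqP; rewrite -subr_eq0; apply/eqP.
have -> : (a^`M(i) * b - a * b^`M(i)) * q ^+ 2
    - (p^`M(i) * q - p * q^`M(i)) * b ^+ 2
  = (p * b - a * q) * (b^`M(i) * q + b * q^`M(i))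
    - b * q * ((p^`M(i) * b + p * b^`M(i)) - (a^`M(i) * q + a * q^`M(i))) by ring.
by rewrite dE E !subrr mulr0 mul0r subrr.
Qed.

Lemma ratfunP x : exists p q, q != 0 /\ x = ratpoly p / ratpoly q.
Proof.
by exists (ratfun_num x), (ratfun_den x); rewrite ratfun_den_neq0 -ratfun_numden.
Qed.

Lemma ratfun_deriv_poly i p : ratfun_deriv i (ratpoly p) = ratpoly p^`M(i).
Proof.
have -> : ratpoly p = ratpoly p / ratpoly 1 by rewrite ratpoly1 divr1.
rewrite ratfun_derivE ?oner_neq0 // ratpoly1 expr1n divr1.
by rewrite -[1%R]/(1%:MP) mderivC mulr1 mulr0 subr0.
Qed.

Lemma ratfun_derivD i : {morph ratfun_deriv i : x y / x + y}.
Proof.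
move=> x y; have [a [b [b0 ->]]] := ratfunP x; have [c [d [d0 ->]]] := ratfunP y.
have nb : ratpoly b != 0 by rewrite ratpoly_eq0.
have nd : ratpoly d != 0 by rewrite ratpoly_eq0.
rewrite (addf_div _ _ nb nd) -!ratpolyM -ratpolyD.
rewrite (ratfun_derivE _ _ b0) (ratfun_derivE _ _ d0) ratfun_derivE ?mulf_neq0//.
rewrite !mderivD !mderivM !(ratpolyB, ratpolyM, ratpolyD) /=.
exact: (quotient_ruleD _ _ _ _ _ _ nb nd).
Qed.

Lemma ratfun_derivM i x y :
  ratfun_deriv i (x * y) = ratfun_deriv i x * y + x * ratfun_deriv i y.
Proof.
have [a [b [b0 ->]]] := ratfunP x; have [c [d [d0 ->]]] := ratfunP y.
have nb : ratpoly b != 0 by rewrite ratpoly_eq0.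
have nd : ratpoly d != 0 by rewrite ratpoly_eq0.
rewrite mulf_div -!ratpolyM.
rewrite (ratfun_derivE _ _ b0) (ratfun_derivE _ _ d0) ratfun_derivE ?mulf_neq0//.
rewrite !mderivM !(ratpolyB, ratpolyM, ratpolyD) /=.
exact: (quotient_ruleM _ _ _ _ _ _ nb nd).
Qed.

Fact ratfun_deriv_linear i : linear (ratfun_deriv i).
Proof.
move=> a x y; rewrite ratfun_derivD !ratfun_scaleE ratfun_derivM.
by rewrite ratfun_deriv_poly mderivC ratpoly0 mul0r add0r.
Qed.
HB.instance Definition _ i := GRing.isLinear.Build K ratfun ratfun _
  (ratfun_deriv i) (ratfun_deriv_linear i).

Lemma ratfun_derivC i j x :
  ratfun_deriv i (ratfun_deriv j x) = ratfun_deriv j (ratfun_deriv i x).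
Proof.
have [p [q [q0 xE]]] := ratfunP x.
have nq : ratpoly q != 0 by rewrite ratpoly_eq0.
have {xE} xE : x * ratpoly q = ratpoly p by rewrite xE divfK.
have E k l : ratfun_deriv k (ratfun_deriv l x) * ratpoly q =
    ratpoly p^`M(l)^`M(k) - (ratfun_deriv l x * ratpoly q^`M(k)
      + ratfun_deriv k x * ratpoly q^`M(l) + x * ratpoly q^`M(l)^`M(k)).
  rewrite -!ratfun_deriv_poly -xE !ratfun_derivM ratfun_derivD !ratfun_derivM.
  exact: leibniz2.
apply: (mulIf nq); rewrite (E i j) (E j i) (mderiv_comm j i p) (mderiv_comm j i q).
by congr (_ - (_ + _)); apply: addrC.
Qed.

Definition ratfun_mulX (i : 'I_n) (x : ratfun) : ratfun := ratpoly 'X_i * x.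
Fact ratfun_mulX_linear i : linear (ratfun_mulX i).
Proof. by move=> a x y; rewrite /ratfun_mulX !ratfun_scaleE mulrDr mulrCA. Qed.
HB.instance Definition _ i := GRing.isLinear.Build K ratfun ratfun _
  (ratfun_mulX i) (ratfun_mulX_linear i).

Lemma ratfun_derivX i j x : ratfun_deriv i (ratfun_mulX j x) =
  ratfun_mulX j (ratfun_deriv i x) + x *+ (i == j).
Proof.
rewrite /ratfun_mulX ratfun_derivM ratfun_deriv_poly addrC; congr (_ + _).
rewrite mderivX mnmE eq_sym; case: eqVneq => [->|_] /=.
  by rewrite -{1}[U_(j)%MM]add0m addmK mpolyX0 scale1r ratpoly1 mul1r.
by rewrite scale0r ratpoly0 mul0r.
Qed.

(** R_f inside Frac R; this is the localization only for [f != 0], since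
    0^-1 = 0 here. *)
Definition localization (f : {mpoly K[n]}) : {pred ratfun} :=
  [pred x | `[< exists p k, x = ratpoly p / ratpoly f ^+ k >]].

Lemma localizationP f x :
  reflect (exists p k, x = ratpoly p / ratpoly f ^+ k) (x \in localization f).
Proof. exact: asboolP. Qed.

Fact localization_submod f : submod_closed (localization f).
Proof.
split=> [|a _ _ /localizationP[p [k ->]] /localizationP[q [l ->]]].
  by apply/localizationP; exists 0, 0%N; rewrite ratpoly0 mul0r.
apply/localizationP; rewrite ratfun_scaleE; have [->|f0] := eqVneq f 0.
  exists (a%:MP * p * 0 ^+ k + q * 0 ^+ l), 0%N.
  by rewrite ratpoly0 invr1 mulr1 !(ratpolyD, ratpolyM, ratpolyX) /= ratpoly0
    -!exprVn invr0 mulrA.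
have nf : ratpoly f != 0 by rewrite ratpoly_eq0.
exists (a%:MP * p * f ^+ l + q * f ^+ k), (k + l)%N.
rewrite !(ratpolyD, ratpolyM, ratpolyX) /= exprD mulrA.
by rewrite addf_div ?expf_neq0.
Qed.
HB.instance Definition _ f := GRing.isSubmodClosed.Build K ratfun
  (localization f) (localization_submod f).

Lemma localization_mulX i f : {homo ratfun_mulX i : x / x \in localization f}.
Proof.
move=> _ /localizationP[p [k ->]]; apply/localizationP.
by exists ('X_i * p), k; rewrite /ratfun_mulX ratpolyM mulrA.
Qed.

Lemma localization_deriv i f : f != 0 ->
  {homo ratfun_deriv i : x / x \in localization f}.
Proof.
move=> f0 _ /localizationP[p [k ->]]; apply/localizationP.
rewrite -ratpolyX ratfun_derivE ?expf_neq0 //.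
by eexists _, (k * 2)%N; rewrite exprM ratpolyX; reflexivity.
Qed.

Section Grading.
Variable w : 'I_n -> nat.

(** Homogeneous rational functions of degree d. On a localization R_f with f
    homogeneous this gives the usual grading. *)
Definition ratfun_deg (d : int) : {pred ratfun} :=
  [pred x | `[< x = 0 \/ exists p q k l, [/\ q != 0,
      p \is k.-homog for (wdeg w), q \is l.-homog for (wdeg w),
      d = k%:Z - l%:Z & x = ratpoly p / ratpoly q] >]].

Lemma ratfun_degP d x :
  reflect (x = 0 \/ exists p q k l, [/\ q != 0,
    p \is k.-homog for (wdeg w), q \is l.-homog for (wdeg w),
    d = k%:Z - l%:Z & x = ratpoly p / ratpoly q]) (x \in ratfun_deg d).
Proof. exact: asboolP. Qed.

Fact ratfun_deg_submod d : submod_closed (ratfun_deg d).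
Proof.
split=> [|a x y]; first by apply/ratfun_degP; left.
move=> /ratfun_degP xd /ratfun_degP yd; apply/ratfun_degP.
case: xd => [->|[p [q [a1 [b1 [q0 hp hq dE ->]]]]]]; first by rewrite scaler0 add0r.
case: yd => [->|[p' [q' [a2 [b2 [q0' hp' hq' dE' ->]]]]]]; right.
  exists (a *: p), q, a1, b1; split=> //; first exact: dhomogZ.
  by rewrite addr0 ratfun_scaleE mulrA -ratpolyM mul_mpolyC.
exists (a *: p * q' + p' * q), (q * q'), (a1 + b2)%N, (b1 + b2)%N; split.
- by rewrite mulf_neq0.
- apply: rpredD; first by apply: dhomogM => //; apply: dhomogZ.
  have -> : (a1 + b2 = a2 + b1)%N.
    by apply/eqP; rewrite -eqz_nat !PoszD -subr_eq addrAC -dE dE' subrK.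
  exact: dhomogM.
- exact: dhomogM.
- by rewrite dE !PoszD opprD addrACA subrr addr0.
rewrite ratfun_scaleE mulrA -ratpolyM mul_mpolyC ratpolyD !ratpolyM.
by rewrite addf_div ?ratpoly_eq0.
Qed.
HB.instance Definition _ d := GRing.isSubmodClosed.Build K ratfun
  (ratfun_deg d) (ratfun_deg_submod d).

Lemma ratfun_deg_mulX i d x :
  x \in ratfun_deg d -> ratfun_mulX i x \in ratfun_deg (d + (w i)%:Z).
Proof.
move=> /ratfun_degP[->|[p [q [a [b [q0 hp hq -> ->]]]]]]; first by rewrite raddf0 rpred0.
apply/ratfun_degP; right; exists ('X_i * p), q, (w i + a)%N, b; split=> //.
- by apply: dhomogM => //; rewrite dhomogX; apply/eqP/wdegU.
- by rewrite PoszD addrAC [_ + a%:Z]addrC.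
by rewrite /ratfun_mulX mulrA ratpolyM.
Qed.

Lemma ratfun_deg_deriv i d x :
  x \in ratfun_deg d -> ratfun_deriv i x \in ratfun_deg (d - (w i)%:Z).
Proof.
move=> /ratfun_degP[->|[p [q [a [b [q0 hp hq -> ->]]]]]]; first by rewrite raddf0 rpred0.
rewrite ratfun_derivE // ratpolyB mulrBl; apply: submod_rpredB; apply/ratfun_degP.
  case: (dhomog_mderiv i hp) => [->|[e aE he]].
    by left; rewrite mul0r ratpoly0 mul0r.
  right; exists (p^`M(i) * q), (q ^+ 2), (e + b)%N, (b * 2)%N; split.
  - exact: expf_neq0.
  - exact: dhomogM.
  - exact: dhomogMn.
  - by rewrite aE muln2 -addnn !PoszD; ring.
  - by rewrite ratpolyX.
case: (dhomog_mderiv i hq) => [->|[e bE he]].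
  by left; rewrite mulr0 ratpoly0 mul0r.
right; exists (p * q^`M(i)), (q ^+ 2), (a + e)%N, (b * 2)%N; split.
- exact: expf_neq0.
- exact: dhomogM.
- exact: dhomogMn.
- by rewrite bE muln2 -addnn !PoszD; ring.
- by rewrite ratpolyX.
Qed.


Lemma ratfun_common_den (r : seq int) (y : int -> ratfun) :
  (forall d, y d \in ratfun_deg d) ->
  exists H h (P : int -> {mpoly K[n]}), [/\ H != 0,
    H \is h.-homog for (wdeg w),
    forall d, d \in r -> y d * ratpoly H = ratpoly (P d) &
    forall d, P d = 0 \/
      exists2 k, d + h%:Z = k%:Z & P d \is k.-homog for (wdeg w)].
Proof.
move=> yG; elim: r => [|e r [H [h [P [H0 hH yP PG]]]]].
  exists 1, 0%N, (fun=> 0); split=> [|||d]; last by left.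
  - exact: oner_neq0.
  - exact: dhomog1.
  - by [].
have /ratfun_degP[ye|[p [q [k [l [q0 hp hq eE yE]]]]]] := yG e.
  exists H, h, (fun d => if d == e then 0 else P d); split=> // [d|d].
    rewrite inE; have [->|de] := eqVneq d e; last exact: yP.
    by rewrite ye mul0r ratpoly0.
  by case: eqP => _; [left|exact: PG].
exists (H * q), (h + l)%N, (fun d => if d == e then p * H else P d * q); split.
- by rewrite mulf_neq0.
- exact: dhomogM.
- move=> d; rewrite inE; have [->|de] := eqVneq d e.
    rewrite yE ratpolyM [ratpoly H * _]mulrC mulrA divfK ?ratpoly_eq0 //.
    by rewrite ratpolyM.
  by move=> /= /yP E; rewrite ratpolyM mulrA E ratpolyM.
move=> d; case: eqP => [->|_].
  right; exists (k + h)%N; last exact: dhomogM.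
  by rewrite eE !PoszD; ring.
case: (PG d) => [->|[m mE hm]]; [by left; rewrite mul0r|right].
by exists (m + l)%N; [rewrite !PoszD addrA mE|apply: dhomogM].
Qed.

Lemma ratfun_independent : independent ratfun_deg.
Proof.
move=> r y ur yG y0 d dr.
have [H [h [P [H0 hH yP PG]]]] := ratfun_common_den r yG.
have sP : \sum_(e <- r) P e = 0.
  apply/eqP; rewrite -ratpoly_eq0 raddf_sum.
  have -> : \sum_(e <- r) ratpoly (P e) = \sum_(e <- r) y e * ratpoly H.
    by rewrite big_seq [RHS]big_seq; apply: eq_bigr => e /yP->.
  by rewrite -mulr_suml y0 mul0r.
suff P0 : P d = 0.
  have /eqP := yP d dr; rewrite P0 ratpoly0 mulf_eq0 ratpoly_eq0 (negbTE H0) orbF.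
  by move/eqP.
case: (PG d) => [//|[k kE hk]].
have : pihomog (wdeg w) k (\sum_(e <- r) P e) = 0 by rewrite sP raddf0.
rewrite raddf_sum (bigD1_seq d) //= (pihomog_dE hk) big1 ?addr0 // => e ed.
case: (PG e) => [->|[m mE hm]]; first by rewrite raddf0.
apply: pihomog_ne0 hm; apply: contraNneq ed => E.
by apply/eqP/(@addIr _ h%:Z); rewrite kE mE E.
Qed.

Lemma localization_graded f e : f != 0 -> f \is e.-homog for (wdeg w) ->
  graded_pred ratfun_deg (localization f).
Proof.
move=> f0 hf _ /localizationP[p [k ->]].
pose N := mmeasure (wdeg w) p.
pose s (d : nat) : int := d%:Z - (e * k)%:Z.
have s_inj : injective s by move=> a b /addIr[].
exists [seq s d | d <- iota 0 N].
exists (fun d => if d + (e * k)%:Z is Posz m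
  then ratpoly (pihomog (wdeg w) m p) / ratpoly f ^+ k else 0); split.
- by rewrite map_inj_uniq ?iota_uniq.
- move=> d; case E: (d + _) => [m|m]; last exact: rpred0.
  apply/ratfun_degP; right.
  exists (pihomog (wdeg w) m p), (f ^+ k), m, (e * k)%N; split.
  + exact: expf_neq0.
  + exact: pihomogP.
  + exact: dhomogMn.
  + by rewrite -E addrK.
  + by rewrite ratpolyX.
- move=> d; case: (d + _) => m; last exact: rpred0.
  by apply/localizationP; exists (pihomog (wdeg w) m p), k.
rewrite big_map (eq_bigr (fun d => ratpoly (pihomog (wdeg w) d p) / ratpoly f ^+ k)).
  rewrite -mulr_suml -raddf_sum; congr (ratpoly _ / _).
  by rewrite {1}(pihomog_partitionE (leqnn N)) -(big_mkord xpredT (fun d => pihomog (wdeg w) d p)) /index_iota subn0.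
by move=> d _; rewrite /s subrK.
Qed.

End Grading.
End Ratfun.
Arguments ratfun_deg K {n} w d.

(** By noetherianity every graded ideal has such a system of generators; the
    empty system generates the zero ideal. *)
Record homogeneous_generators (K : fieldType) (n : nat) (w : 'I_n -> nat)
  (I : {pred {mpoly K[n]}}) := HomogeneousGenerators {
  hg_size : nat;
  hg_gen :> 'I_hg_size -> {mpoly K[n]};
  hg_neq0 : forall t, hg_gen t != 0;
  hg_homog : forall t, exists d, hg_gen t \is d.-homog for (wdeg w);
  hg_ideal : forall p, p \in I <->
    exists a : 'I_hg_size -> {mpoly K[n]}, p = \sum_t a t * hg_gen t
}.

Section LocalCohomology.
Variables (K : fieldType) (n : nat) (w : 'I_n -> nat) (I : {pred {mpoly K[n]}}).
Variable f : homogeneous_generators w I.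

Notation s := (hg_size f).
Notation cochain := {ffun {set 'I_s} -> ratfun K n}.

(** The Cech complex of f_0, ..., f_(s-1): a cochain in degree j is a family
    c(S) \in R_{f_S}, #|S| = j, where f_S = \prod_(t in S) f_t, and
    (d c)(S) = \sum_k (-1)^(k-1) c(S \ t_k) for S = {t_1 < t_2 < ...}; the
    maps R_{f_{S \ t}} -> R_{f_S} are inclusions inside Frac R. *)
Definition cech_fun (c : cochain) : cochain :=
  [ffun S : {set 'I_s} => \sum_(t in S) pos_sign K S t *: c (S :\ t)].

Fact cech_fun_linear : linear cech_fun.
Proof.
move=> a x y; apply/ffunP => S; rewrite !ffunE scaler_sumr -big_split /=.
apply: eq_bigr => t _; rewrite !ffunE scalerDr !scalerA.
by rewrite [_ * a]mulrC.
Qed.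
HB.instance Definition _ := GRing.isLinear.Build K cochain cochain
  _ cech_fun cech_fun_linear.

Definition cech_cochains (j : int) : submodClosed cochain :=
  ffun_sub (fun S : {set 'I_s} =>
    cond_sub (#|S|%:Z == j) (localization (\prod_(t in S) f t))).

Definition cech_deg (d : int) : submodClosed cochain :=
  ffun_sub (fun=> ratfun_deg K w d).

Lemma cech_den_neq0 (S : {set 'I_s}) : \prod_(t in S) f t != 0.
Proof. by apply/prodf_neq0 => t _; apply: hg_neq0. Qed.

Lemma cech_den_homog (S : {set 'I_s}) :
  exists d, \prod_(t in S) f t \is d.-homog for (wdeg w).
Proof.
elim/big_rec: _ => [|t p _ [d hp]]; first by exists 0%N; apply: dhomog1.
by have [e he] := hg_homog t; exists (e + d)%N; apply: dhomogM.
Qed.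

Lemma cech_independent : independent cech_deg.
Proof.
apply: (@ffun_independent _ _ _ (fun=> ratfun_deg K w)) => _.
exact: ratfun_independent.
Qed.

Lemma cech_cochains_graded j : graded_pred cech_deg (cech_cochains j).
Proof.
apply: (@ffun_graded _ _ _ (fun=> ratfun_deg K w)) => S.
apply: cond_sub_graded => _; have [d hd] := cech_den_homog S.
exact: localization_graded (cech_den_neq0 S) hd.
Qed.

Lemma cech_fun_deg d : {homo cech_fun : c / c \in cech_deg d}.
Proof.
move=> c /ffun_subP cG; apply/ffun_subP => S; rewrite ffunE.
by apply: rpred_sum => t tS; apply: rpredZ.
Qed.

Lemma cech_fun_map (F : {linear ratfun K n -> ratfun K n}) c :
  ffun_map F (cech_fun c) = cech_fun (ffun_map F c).
Proof.
apply/ffunP => S; rewrite !ffunE raddf_sum; apply: eq_bigr => t _.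
by rewrite /= linearZ ffunE.
Qed.

Lemma cech_cochains_map (F : {linear ratfun K n -> ratfun K n}) j :
  (forall p, p != 0 -> {homo F : x / x \in localization p}) ->
  {homo ffun_map F : c / c \in cech_cochains j}.
Proof.
move=> FL c /ffun_subP cC; apply/ffun_subP => S; rewrite ffunE.
exact: (cond_sub_map (FL _ (cech_den_neq0 S)) (cC S)).
Qed.

Definition local_cohomology_space (j : int) : gradedSpace K :=
  homology (dd := cech_fun) cech_independent (@cech_cochains_graded j)
    (@cech_cochains_graded (j - 1)) cech_fun_deg.

Definition local_cohomology_X (j : int) (i : 'I_n) :
    {linear local_cohomology_space j -> local_cohomology_space j} :=
  homology_map cech_independent (@cech_cochains_graded j)
    (@cech_cochains_graded (j - 1)) cech_fun_deg
    (cech_fun_map (ratfun_mulX i))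
    (@cech_cochains_map (ratfun_mulX i) j (fun p _ => @localization_mulX K n i p))
    (@cech_cochains_map (ratfun_mulX i) (j - 1)
       (fun p _ => @localization_mulX K n i p)).

Definition local_cohomology_D (j : int) (i : 'I_n) :
    {linear local_cohomology_space j -> local_cohomology_space j} :=
  homology_map cech_independent (@cech_cochains_graded j)
    (@cech_cochains_graded (j - 1)) cech_fun_deg
    (cech_fun_map (ratfun_deriv i))
    (@cech_cochains_map (ratfun_deriv i) j (@localization_deriv K n i))
    (@cech_cochains_map (ratfun_deriv i) (j - 1) (@localization_deriv K n i)).

Lemma local_cohomology_XX j i k m :
  local_cohomology_X j i (local_cohomology_X j k m)
    = local_cohomology_X j k (local_cohomology_X j i m).
Proof.
rewrite -[RHS]addr0; apply: (@subquot_map_comm _ _ _ _ _ _ 0).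
apply: (@ffun_map_comm _ _ _ _ _ 0) => x.
by rewrite addr0 /= /ratfun_mulX mulrCA.
Qed.

Lemma local_cohomology_DD j i k m :
  local_cohomology_D j i (local_cohomology_D j k m)
    = local_cohomology_D j k (local_cohomology_D j i m).
Proof.
rewrite -[RHS]addr0; apply: (@subquot_map_comm _ _ _ _ _ _ 0).
apply: (@ffun_map_comm _ _ _ _ _ 0) => x.
by rewrite addr0 /= ratfun_derivC.
Qed.

Lemma local_cohomology_DX j i k m :
  local_cohomology_D j i (local_cohomology_X j k m)
    = local_cohomology_X j k (local_cohomology_D j i m) + m *+ (i == k).
Proof.
apply: (@subquot_map_comm _ _ _ _ _ _ (i == k)).
apply: (@ffun_map_comm _ _ _ _ _ (i == k)) => x.
exact: ratfun_derivX.
Qed.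

Lemma local_cohomology_X_deg j i d m :
  m \in gs_deg (local_cohomology_space j) d ->
  local_cohomology_X j i m \in gs_deg (local_cohomology_space j) (d + (w i)%:Z).
Proof.
apply: homology_map_deg => {m}d c /ffun_subP cG.
by apply/ffun_subP => S; rewrite ffunE; apply: ratfun_deg_mulX.
Qed.

Lemma local_cohomology_D_deg j i d m :
  m \in gs_deg (local_cohomology_space j) d ->
  local_cohomology_D j i m \in gs_deg (local_cohomology_space j) (d - (w i)%:Z).
Proof.
apply: homology_map_deg => {m}d c /ffun_subP cG.
by apply/ffun_subP => S; rewrite ffunE; apply: ratfun_deg_deriv.
Qed.

(** H^j_I(R), zero for j < 0. The localizations R_{f_S} are graded left
    A_n(K)-modules and the Cech differentials are A_n(K)-linear of degree 0;
    this defines the structure of graded left A_n(K)-module, which up to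
    isomorphism does not depend on [f]. *)
Definition local_cohomology (j : int) : gradedWeylModule K w :=
  GradedWeylModule (@local_cohomology_XX j) (@local_cohomology_DD j)
    (@local_cohomology_DX j) (@local_cohomology_X_deg j)
    (@local_cohomology_D_deg j).

End LocalCohomology.

(* Main.v *)
Require Import Defs.
From mathcomp Require Import all_boot all_order all_algebra ring.
From mathcomp Require Import mpoly.
From mathcomp Require Import boolp.

Set Implicit Arguments.
Unset Strict Implicit.
Unset Printing Implicit Defensive.

Import GRing.Theory Num.Theory.
Local Open Scope ring_scope.

(** The Euler operator [\sum_t w_t X_t D_t] multiplies a homogeneous rational
    function of degree d by d ([ratfun_euler]).  Local cohomology is a
    subquotient of a sum of copies of Frac R, with X_t and D_t acting
    componentwise; hence the Euler operator acts on its component of degree d as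
    the scalar d ([local_cohomology_eulerian]).

    For any such module M, let h be the exterior product by
    [\sum_t w_t X_t e_t] on the Koszul complex of D_1, ..., D_n, whose
    differential is d.  Cartan's formula says that d h + h d multiplies the
    summand M e_S by the operator
    [\sum_(t in S) w_t X_t D_t + \sum_(t notin S) w_t D_t X_t], which is the
    Euler operator plus the scalar [\sum_(t notin S) w_t], since
    D_t X_t = X_t D_t + 1 ([koszul_cartan]).  If m e_S has degree l in the
    complex, then m has degree [l + \sum_(t in S) w_t] in M, so the two scalars
    add up to l + omega, whatever S is ([koszul_homotopy]).  In characteristic
    zero this number is invertible in K for l <> - omega, and then h contracts
    the piece of degree l of the complex ([eulerian_deRham_homology_eq0]). *)

Lemma dhomog_euler (K : fieldType) (n : nat) (w : 'I_n -> nat) (d : nat)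
    (p : {mpoly K[n]}) : p \is d.-homog for (wdeg w) ->
  \sum_(t < n) (w t)%:R *: ('X_t * p^`M(t)) = d%:R *: p.
Proof.
move=> /dhomogP hp; rewrite {2}[p]mpolyE scaler_sumr /mderiv.
under eq_bigr => t _ do rewrite mulr_sumr scaler_sumr.
rewrite exchange_big /= big_seq [RHS]big_seq; apply: eq_bigr => m /hp <-.
(* For m t = 0 the truncated exponent m - U_(t) is meaningless, but its
   coefficient is zero. *)
rewrite /wdeg /= natr_sum scaler_suml; apply: eq_bigr => t _.
rewrite -scalerAr -mpolyXD !scalerA natrM; have [m0|m0] := eqVneq (m t) 0%N.
  by rewrite m0 !(mulr0, mul0r) !scale0r.
rewrite addmC submK ?lep1mP //; congr (_ *: 'X_[_]); ring.
Qed.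

(** Both sides of [x * q = p] are differentiated by the Euler operator, which
    is a derivation of Frac R: this reduces the formula to the one for the
    polynomials p and q. *)
Lemma ratfun_euler (K : fieldType) (n : nat) (w : 'I_n -> nat) (d : int)
    (x : ratfun K n) : x \in ratfun_deg K w d ->
  \sum_(t < n) (w t)%:R *: ratfun_mulX t (ratfun_deriv t x) = d%:~R *: x.
Proof.
move=> /ratfun_degP[->|[p [q [k [l [q0 hp hq -> xE]]]]]].
  by rewrite scaler0 big1 // => t _; rewrite !linear0.
have nq : ratpoly q != 0 by rewrite ratpoly_eq0.
have {}xE : x * ratpoly q = ratpoly p by rewrite xE divfK.
have scaleMl a (y z : ratfun K n) : (a *: y) * z = a *: (y * z).
  by rewrite !ratfun_scaleE mulrA.
have scaleMr a (y z : ratfun K n) : y * (a *: z) = a *: (y * z).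
  by rewrite !ratfun_scaleE mulrCA.
pose E (y : ratfun K n) :=
  \sum_(t < n) (w t)%:R *: ratfun_mulX t (ratfun_deriv t y).
have EM y z : E (y * z) = E y * z + y * E z.
  rewrite /E mulr_suml mulr_sumr -big_split; apply: eq_bigr => t _ /=.
  rewrite scaleMl scaleMr -scalerDr ratfun_derivM /ratfun_mulX.
  by congr (_ *: _); rewrite mulrDr mulrA; congr (_ + _); rewrite mulrCA.
have EP m r : r \is m.-homog for (wdeg w) -> E (ratpoly r) = m%:R *: ratpoly r.
  move=> /dhomog_euler hr; rewrite ratfun_scaleE -ratpolyM mul_mpolyC -hr.
  rewrite raddf_sum; apply: eq_bigr => t _.
  rewrite ratfun_deriv_poly /ratfun_mulX -ratpolyM ratfun_scaleE -ratpolyM.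
  by rewrite mul_mpolyC.
apply: (mulIf nq); rewrite -/(E x); apply: (@addIr _ (x * E (ratpoly q))).
rewrite -EM xE (EP _ _ hp) (EP _ _ hq) scaleMl scaleMr xE -scalerDl.
by rewrite intrB subrK.
Qed.

Definition eulerian (K : fieldType) (n : nat) (w : 'I_n -> nat)
    (M : gradedWeylModule K w) : Prop :=
  forall (d : int) (m : M), m \in gs_deg M d ->
    \sum_(t < n) (w t)%:R *: gwm_X M t (gwm_D M t m) = d%:~R *: m.

Lemma subquot_pi_lincomb (K : fieldType) (V : lmodType K)
    (Z B : submodClosed V) (T : finType) (a : T -> K) (y : T -> submod Z)
    (b : K) (z : submod Z) :
  \sum_t a t *: val (y t) = b *: val z ->
  \sum_t a t *: subquot_pi B (y t) = b *: subquot_pi B z.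
Proof.
move=> yz; under eq_bigr => t _ do rewrite -linearZ.
rewrite -raddf_sum -linearZ; congr subquot_pi; apply: val_inj.
by rewrite raddf_sum linearZ /= -yz; apply: eq_bigr.
Qed.

Lemma local_cohomology_eulerian (K : fieldType) (n : nat) (w : 'I_n -> nat)
    (I : {pred {mpoly K[n]}}) (f : homogeneous_generators w I) (j : int) :
  eulerian (local_cohomology f j).
Proof.
move=> d _ /subquot_imP[z -> zG].
have /choice[y yE] t : exists y : submod _,
    gwm_X (local_cohomology f j) t
      (gwm_D (local_cohomology f j) t (subquot_pi _ z)) = subquot_pi _ y /\
    val y = ffun_map (ratfun_mulX t) (ffun_map (ratfun_deriv t) (val z)).
  eexists; split.
    apply: etrans (congr1 (gwm_X (local_cohomology f j) t) _) _.
      exact: subquot_mapE.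
    exact: subquot_mapE.
  by [].
under eq_bigr => t _ do rewrite (yE t).1.
apply: subquot_pi_lincomb; apply/ffunP => S; rewrite sum_ffunE [RHS]ffunE.
have /ffun_subP/(_ S)/ratfun_euler <- := zG.
by apply: eq_bigr => t _; rewrite (yE t).2 !ffunE.
Qed.

Lemma pos_sign_sqr (R : pzRingType) (n : nat) (S : {set 'I_n}) (t : 'I_n) :
  pos_sign R S t * pos_sign R S t = 1.
Proof. by rewrite /pos_sign -exprD addnn -mul2n exprM sqrrN !expr1n. Qed.

Lemma pos_signU (R : pzRingType) (n : nat) (S : {set 'I_n}) (t u : 'I_n) :
  t \notin S ->
  pos_sign R (t |: S) u = (-1) ^+ (t < u)%N * pos_sign R S u.
Proof.
move=> tS; rewrite /pos_sign -exprD; congr (_ ^+ _).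
have [tu|ut] := boolP (t < u)%N.
  have -> : [set v in t |: S | (v < u)%N] = t |: [set v in S | (v < u)%N].
    by apply/setP => v; rewrite !inE; case: eqVneq => // ->.
  by rewrite cardsU1 inE (negbTE tS).
rewrite add0n; apply: eq_card => v; rewrite !inE.
by case: eqVneq => // ->; rewrite (negbTE ut) !andbF.
Qed.

(** Contraction by one basis vector anticommutes with the exterior product by
    another one: this makes the mixed terms cancel in [koszul_cartan]. *)
Lemma pos_sign_anticomm (R : pzRingType) (n : nat) (S : {set 'I_n})
    (t u : 'I_n) : t \notin S -> u \in S ->
  pos_sign R S t * pos_sign R (t |: S) u
    = - (pos_sign R S u * pos_sign R (S :\ u) t).
Proof.
move=> tS uS; rewrite (pos_signU R _ tS).
have uS' : u \notin S :\ u by rewrite setD11.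
have := pos_signU R t uS'; rewrite setD1K // => ->.
rewrite -[RHS]mulN1r /pos_sign -!exprD -exprS -[LHS]signr_odd -[RHS]signr_odd /=; congr (_ ^+ _).
rewrite !oddD; case: (ltngtP t u) => [_|_|/val_inj tu]; last by rewrite tu uS in tS.
  by do 2!case: (odd #|_|).
by do 2!case: (odd #|_|).
Qed.

Section KoszulHomotopy.
Variables (K : fieldType) (n : nat) (w : 'I_n -> nat).
Variable M : gradedWeylModule K w.

Notation chain := {ffun {set 'I_n} -> M}.
Notation d := (@koszul_fun K n w M).

(** The exterior product by [\sum_u w_u X_u e_u]. *)
Definition euler_wedge (c : chain) : chain :=
  [ffun S : {set 'I_n} => \sum_(u in S)
     ((w u)%:R * pos_sign K S u) *: gwm_X M u (c (S :\ u))].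

(** Applying both maps in either order, the terms that contract and multiply by
    the same basis vector keep e_S: it is multiplied first, then contracted, for
    t outside S, and the other way round for t in S.  The terms with two
    different basis vectors cancel.  Commuting D_t past X_t in the terms with
    t outside S produces the multiple of [c S] on the right. *)
Lemma koszul_cartan (c : chain) (S : {set 'I_n}) :
  (d (euler_wedge c) + euler_wedge (d c)) S
    = \sum_t (w t)%:R *: gwm_X M t (gwm_D M t (c S))
      + (\sum_(t | t \notin S) (w t)%:R) *: c S.
Proof.
(* [cross t u] is the term of [euler_wedge (d c)] at S for u <> t. *)
pose cross t u := ((w u)%:R * (pos_sign K S u * pos_sign K (S :\ u) t)) *:
  gwm_X M u (gwm_D M t (c (t |: (S :\ u)))).
have dhE : d (euler_wedge c) S =
    \sum_(t | t \notin S) (w t)%:R *: gwm_X M t (gwm_D M t (c S))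
    + (\sum_(t | t \notin S) (w t)%:R) *: c S
    - \sum_(t | t \notin S) \sum_(u in S) cross t u.
  rewrite ffunE scaler_suml -big_split -sumrB /=.
  apply: eq_bigr => t tS; rewrite ffunE big_setU1 //= setU1K //.
  rewrite linearD scalerDr linearZ /= gwm_DX eqxx mulr1n scalerA.
  have tt : pos_sign K S t * ((w t)%:R * pos_sign K (t |: S) t) = (w t)%:R.
    by rewrite pos_signU // ltnn mul1r mulrCA pos_sign_sqr mulr1.
  rewrite tt scalerDr; congr (_ + _).
  rewrite linear_sum scaler_sumr -sumrN; apply: eq_bigr => u uS.
  have tu : (t == u) = false by apply: contraNF tS => /eqP->.
  have -> : (t |: S) :\ u = t |: (S :\ u).
    apply/setP => v; rewrite !inE; case: eqVneq => //= ->.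
    by rewrite eq_sym tu.
  rewrite linearZ /= gwm_DX tu addr0 scalerA /cross -scaleNr; congr (_ *: _).
  by rewrite mulrCA pos_sign_anticomm // mulrN.
have hdE : euler_wedge (d c) S =
    \sum_(u in S) (w u)%:R *: gwm_X M u (gwm_D M u (c S))
    + \sum_(t | t \notin S) \sum_(u in S) cross t u.
  rewrite ffunE exchange_big -big_split /=; apply: eq_bigr => u uS.
  rewrite ffunE (bigD1 u) ?setD11 //= setD1K // linearD scalerDr.
  congr (_ + _).
    rewrite linearZ /= scalerA; congr (_ *: _).
    have uS' : u \notin S :\ u by rewrite setD11.
    have := pos_signU K u uS'; rewrite setD1K // ltnn mul1r => ->.
    by rewrite -mulrA pos_sign_sqr mulr1.
  rewrite linear_sum scaler_sumr; apply: eq_big => [t|t _].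
    rewrite !inE; case: eqVneq => [->|_]; first by rewrite uS.
    by rewrite andbT.
  by rewrite linearZ /= scalerA -mulrA.
rewrite ffunE dhE hdE addrACA addNr addr0 addrAC; congr (_ + _).
by rewrite [RHS](bigID (mem S)) addrC.
Qed.

Hypothesis eulM : eulerian M.

(** [c S] has degree [l + \sum_(t in S) w_t] in M, so that the Euler operator
    contributes the weights in S and the correction term those outside S. *)
Lemma koszul_homotopy (l : int) (c : chain) : c \in koszul_deg M l ->
  d (euler_wedge c) + euler_wedge (d c)
    = (l + \sum_(t < n) (w t)%:Z)%:~R *: c.
Proof.
move=> /ffun_subP cG; apply/ffunP => S; rewrite koszul_cartan.
rewrite (eulM (cG S)) ffunE -scalerDl; congr (_ *: _).
rewrite [in RHS](bigID (mem S)) /= addrA !intrD; congr (_ + _).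
by rewrite raddf_sum; apply: eq_bigr.
Qed.

Lemma euler_wedge_chains (i : int) (c : chain) :
  c \in koszul_chains M i -> euler_wedge c \in koszul_chains M (i + 1).
Proof.
move=> /ffun_subP cC; apply/ffun_subP => S; rewrite inE ffunE.
case: eqP => [//|Si]; rewrite big1 // => u uS.
have := cC (S :\ u); rewrite inE; case: eqP => [Ei|_ /eqP ->].
  by case: Si; rewrite (cardsD1 u) uS add1n -addn1 PoszD Ei.
by rewrite linear0 scaler0.
Qed.

Lemma eulerian_deRham_homology_eq0 (i l : int) (x : deRham_homology M i) :
  [pchar K] =i pred0 -> l != - \sum_(t < n) (w t)%:Z ->
  x \in gs_deg (deRham_homology M i) l -> x = 0.
Proof.
move=> /pcharf0P charK hl /subquot_imP[z -> zG]; apply/subquot_eq0.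
set a : K := (l + \sum_(t < n) (w t)%:Z)%:~R.
have a0 : a != 0.
  rewrite /a; move: hl; rewrite -addr_eq0; case: (l + _) => m m0.
    by rewrite -pmulrn charK.
  by rewrite NegzE mulrNz oppr_eq0 -pmulrn charK.
have := submod_valP z; rewrite inE => /andP[zC /eqP dz0].
have h0 : euler_wedge 0 = 0.
  apply/ffunP => S; rewrite !ffunE big1 // => u _.
  by rewrite ffunE linear0 scaler0.
apply/boundariesP; exists (a^-1 *: euler_wedge (val z)).
  by apply: rpredZ; apply: euler_wedge_chains.
have := koszul_homotopy zG; rewrite dz0 h0 addr0 -/a => hz.
by rewrite linearZ /= hz scalerK.
Qed.

End KoszulHomotopy.

Theorem theorem1 (K : fieldType) (n : nat) (w : 'I_n -> nat)
  (I : {pred {mpoly K[n]}}) (f : homogeneous_generators w I)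
  (charK : [pchar K] =i pred0)
  (w_gt0 : forall t : 'I_n, (0 < w t)%N)
  (I_graded : graded_ideal w I)
  (i j : nat) (l : int) (hl : l != - \sum_(t < n) (w t)%:Z)
  (x : deRham_cohomology (local_cohomology f j%:Z) i%:Z)
  (hx : x \in gs_deg (deRham_cohomology (local_cohomology f j%:Z) i%:Z) l) :
  x = 0.
Proof.
apply: eulerian_deRham_homology_eq0 charK hl hx; exact: local_cohomology_eulerian.
Qed.
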